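(* Let $q$ be an odd prime power, let $(u,v,w)\in\mathcal A$ and let $\operatorname{Stab}(u,v,w)$ be its stabiliser in $\operatorname{Aff}(\mathbb F_q)$. For $b\in\mathbb F_q$ let $\iota_b$ denote the involution $x\mapsto -x+b$. (i) Either $\operatorname{Stab}(u,v,w)=1$, or $\operatorname{Stab}(u,v,w)=\langle\iota_b\rangle\cong C_2$ for a unique $b\in\mathbb F_q$; the latter occurs exactly when $u_1=v_1=w_1=-b$. (ii) Every triple in $\mathcal A$ with nontrivial stabiliser lies in $\mathcal D$. (iii) The converse fails: the stabilised locus (the set of triples in $\mathcal A$ with nontrivial stabiliser) is exactly the set of triples in $\mathcal D$ whose three parameter points $(u_1,u_0),(v_1,v_0),(w_1,w_0)$ lie on a vertical line (i.e. $u_1=v_1=w_1$); it has cardinality $q(q-1)(q-2)(q-3)$, whereas $\#\mathcal D=q(q-1)(q-2)(q^2-3q+3)$. The stabilised locus is therefore a proper subset of $\mathcal D$, of relative density $(q-3)/(q^2-3q+3)$.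
   Context: For monic quadratics $u=x^2+u_1x+u_0$, $v=x^2+v_1x+v_0$, $w=x^2+w_1x+w_0$ in $\mathbb F_q[x]$ put $$\mathfrak d(u,v,w)=\det\begin{pmatrix} u_0 & u_1 & 1 \\ v_0 & v_1 & 1 \\ w_0 & w_1 & 1 \end{pmatrix}.$$ $\mathcal A$ is the set of ordered triples $(u,v,w)$ of monic quadratics over $\mathbb F_q$ that are separable and pairwise coprime, and $\mathcal D=\{(u,v,w)\in\mathcal A:\mathfrak d(u,v,w)=0\}$. $\operatorname{Aff}(\mathbb F_q)=\{\alpha_{a,b}:x\mapsto ax+b : a\in\mathbb F_q^\times,\ b\in\mathbb F_q\}$ acts on monic quadratics by $s\mapsto s^{\alpha}:=a^{-2}s(\alpha(x))$ (for $\alpha=\alpha_{a,b}$) and on triples componentwise. *)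

(* Defs.v *)
From HB Require Import structures.
From mathcomp Require Import all_boot all_order all_algebra all_fingroup.
From mathcomp Require Import all_solvable all_field.

Set Implicit Arguments.
Unset Strict Implicit.
Unset Printing Implicit Defensive.

Import GRing.Theory.
Local Open Scope ring_scope.

Section MonicQuadratics.
Variable F : finFieldType.

Record mquad := MQuad {
  mquad_poly :> {poly F};
  mquadP : (mquad_poly \is monic) && (size mquad_poly == 3%N) }.

HB.instance Definition _ := [isSub for mquad_poly].
HB.instance Definition _ := [Countable of mquad by <:].

Fact mquad_of_subproof (c : F * F) :
  let s := 'X^2 + c.1 *: 'X + c.2%:P in (s \is monic) && (size s == 3%N).
Proof.
have size_lo : (size (c.1 *: 'X + c.2%:P)%R < 3)%N.
  rewrite (leq_ltn_trans (size_polyD _ _)) // gtn_max; apply/andP; split.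
    by rewrite (leq_ltn_trans (size_scale_leq _ _)) // size_polyX.
  by rewrite (leq_ltn_trans (size_polyC_leq1 _)).
by rewrite /= -addrA monicE lead_coefDl ?size_polyXn // lead_coefXn eqxx
           size_polyDl ?size_polyXn.
Qed.

Definition mquad_of (c : F * F) : mquad := MQuad (mquad_of_subproof c).
Definition mquad_coefs (s : mquad) : F * F := (s`_1, s`_0).

Lemma mquad_coefsK : cancel mquad_coefs mquad_of.
Proof.
move=> s; apply: val_inj => /=; have /andP[/monicP s_monic /eqP s_size] := mquadP s.
apply/polyP => i; rewrite !(coefD, coefXn, coefZ, coefX, coefC).
case: i => [|[|[|i]]] /=; rewrite ?(mulr0, mulr1, addr0, add0r) //.
  by move: s_monic; rewrite lead_coefE s_size.
by rewrite nth_default ?s_size.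
Qed.

HB.instance Definition _ : isFinite mquad := CanIsFinite mquad_coefsK.

End MonicQuadratics.

Section AffineGroup.
Variable F : finFieldType.

Record aff := Aff { aff_coefs : F * F; _ : aff_coefs.1 != 0 }.

HB.instance Definition _ := [isSub for aff_coefs].
HB.instance Definition _ := [Finite of aff by <:].

Definition aff_a (g : aff) : F := (aff_coefs g).1.
Definition aff_b (g : aff) : F := (aff_coefs g).2.
Definition aff_fun (g : aff) (x : F) : F := aff_a g * x + aff_b g.
Definition aff_poly (g : aff) : {poly F} := aff_a g *: 'X + (aff_b g)%:P.

Lemma aff_a_neq0 (g : aff) : aff_a g != 0. Proof. by case: g. Qed.

Lemma aff_ext (g h : aff) : aff_a g = aff_a h -> aff_b g = aff_b h -> g = h.
Proof.
case: g h => [[a b] /= p] [[c d] /= r]; rewrite /aff_a /aff_b /= => ac bd.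
by apply: val_inj; rewrite /= ac bd.
Qed.

Definition aff_one : aff := @Aff (1, 0) (oner_neq0 F).

Fact aff_mul_subproof (g h : aff) :
  (aff_a g * aff_a h, aff_a g * aff_b h + aff_b g).1 != 0.
Proof. by rewrite /= mulf_neq0 ?aff_a_neq0. Qed.
Definition aff_mul (g h : aff) : aff := Aff (aff_mul_subproof g h).

Fact aff_inv_subproof (g : aff) :
  ((aff_a g)^-1, - ((aff_a g)^-1 * aff_b g)).1 != 0.
Proof. by rewrite /= invr_neq0 ?aff_a_neq0. Qed.
Definition aff_inv (g : aff) : aff := Aff (aff_inv_subproof g).

Fact aff_mulA : associative aff_mul.
Proof.
by move=> g h k; apply: aff_ext; rewrite /aff_a /aff_b /= ?mulrA // mulrDr mulrA addrA.
Qed.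

Fact aff_mul1 : left_id aff_one aff_mul.
Proof. by move=> g; apply: aff_ext; rewrite /aff_a /aff_b /= ?mul1r ?addr0. Qed.

Fact aff_mulV : left_inverse aff_one aff_inv aff_mul.
Proof.
move=> g; apply: aff_ext; first by rewrite /aff_a /= mulVf // aff_a_neq0.
by rewrite /aff_b /= subrr.
Qed.

HB.instance Definition _ := Finite_isGroup.Build aff aff_mulA aff_mul1 aff_mulV.

(* The group law is composition, g * h = g \o h; with it s |-> a^-2 s(g(x)) is a
   right action, as the library requires. *)
Lemma aff_funM (g h : aff) : aff_fun (g * h)%g =1 aff_fun g \o aff_fun h.
Proof.
by move=> x; rewrite /aff_fun /aff_a /aff_b /= mulrDr mulrA addrA.
Qed.

Lemma aff_fun_inj (g h : aff) : aff_fun g =1 aff_fun h -> g = h.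
Proof.
move=> gh; have /eqP := gh 0; rewrite /aff_fun !mulr0 !add0r => /eqP b_eq.
have /eqP := gh 1; rewrite /aff_fun !mulr1 b_eq => /eqP/addIr a_eq.
exact: aff_ext.
Qed.

Fact aff_iota_subproof (b : F) : (- 1 : F, b).1 != 0.
Proof. by rewrite /= oppr_eq0 oner_neq0. Qed.
Definition aff_iota (b : F) : aff := Aff (aff_iota_subproof b).

Lemma aff_iotaE (b x : F) : aff_fun (aff_iota b) x = - x + b.
Proof. by rewrite /aff_fun mulN1r. Qed.

Fact mquad_act_subproof (s : mquad F) (g : aff) :
  let t := (aff_a g) ^- 2 *: (s \Po aff_poly g) in
  (t \is monic) && (size t == 3%N).
Proof.
have /andP[/monicP s_monic /eqP s_size] := mquadP s.
have ag := aff_a_neq0 g; have ag2 : aff_a g ^- 2 != 0 by rewrite invr_neq0 ?expf_neq0.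
have size_lo : (size (aff_b g)%:P < size (aff_a g *: 'X)%R)%N.
  by rewrite size_scale // size_polyX (leq_ltn_trans (size_polyC_leq1 _)).
have size_g : size (aff_poly g) = 2%N.
  by rewrite size_polyDl // size_scale // size_polyX.
have lead_g : lead_coef (aff_poly g) = aff_a g.
  by rewrite lead_coefDl // lead_coefZ lead_coefX mulr1.
rewrite /= monicE lead_coefZ lead_coef_comp ?size_g // s_monic s_size lead_g.
by rewrite mul1r mulVf ?expf_neq0 // eqxx size_scale ?size_comp_poly2 ?s_size.
Qed.
Definition mquad_act (s : mquad F) (g : aff) : mquad F :=
  MQuad (mquad_act_subproof s g).

Fact mquad_act1 (s : mquad F) : mquad_act s 1%g = s.
Proof.
apply: val_inj; rewrite /= /aff_poly /aff_a /aff_b /=.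
by rewrite expr1n invr1 !scale1r addr0 comp_polyXr.
Qed.

Fact mquad_actM (s : mquad F) (g h : aff) :
  mquad_act s (g * h)%g = mquad_act (mquad_act s g) h.
Proof.
apply: val_inj; rewrite /= comp_polyZ scalerA -comp_polyA; congr (_ *: (_ \Po _)).
  by rewrite /aff_a /= exprMn invfM mulrC.
rewrite /aff_poly comp_polyD comp_polyZ comp_polyX comp_polyC /aff_a /aff_b /=.
by rewrite polyCD polyCM scalerDr scalerA mul_polyC addrA.
Qed.

Definition triple := (mquad F * mquad F * mquad F)%type.

Definition triple_act (t : triple) (g : aff) : triple :=
  (mquad_act t.1.1 g, mquad_act t.1.2 g, mquad_act t.2 g).

Fact triple_act1 : forall t, triple_act t 1%g = t.
Proof. by case=> [[u v] w]; rewrite /triple_act !mquad_act1. Qed.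

Fact triple_actM : forall t g h,
  triple_act t (g * h)%g = triple_act (triple_act t g) h.
Proof. by case=> [[u v] w] g h; rewrite /triple_act !mquad_actM. Qed.

Definition triple_action := TotalAction triple_act1 triple_actM.

Definition Stab (t : triple) : {set aff} := 'C[t | triple_action]%g.

End AffineGroup.

Section Loci.
Variable F : finFieldType.

Definition calA : {set triple F} :=
  [set t : triple F | let: (u, v, w) := t in
    [&& separable_poly u, separable_poly v, separable_poly w,
        coprimep u v, coprimep u w & coprimep v w]].

Definition dmx (u v w : mquad F) : 'M[F]_3 :=
  \matrix_(i, j) nth 0 (nth [::] [:: [:: u`_0; u`_1; 1];
                                     [:: v`_0; v`_1; 1];
                                     [:: w`_0; w`_1; 1]] i) j.

Definition calD : {set triple F} :=
  [set t : triple F in calA | let: (u, v, w) := t in \det (dmx u v w) == 0].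

Definition stab_locus : {set triple F} :=
  [set t : triple F in calA | Stab t != 1%g].

End Loci.

(* Main.v *)
Require Import Defs.
From HB Require Import structures.
From mathcomp Require Import all_boot all_order all_algebra all_fingroup.
From mathcomp Require Import all_solvable all_field.
From mathcomp Require Import ring lra.

(** Stabilisers.  Under s |-> a^-2 s(ax + b) the discriminant is divided by
    a^2 ([disc_act]).  A separable quadratic has nonzero discriminant, so an
    affine map fixing it has a = 1 or a = -1, and comparing the coefficients
    of x (2 being invertible) leaves only the identity and the reflection
    x |-> -x - u_1 ([mquad_fix]).  A reflection iota_b fixes a quadratic iff
    its coefficient of x is -b.  So a triple has a nontrivial stabiliser iff
    its three linear coefficients coincide, and then its parameter points lie
    on a vertical line, which makes the determinant vanish.

    Counting.  Each triple of D lies on exactly one line of the parameter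
    plane, and completing the square puts the quadratics of a line, that is, of
    a pencil, in a normal form.

    - On a vertical line they are (X + x)^2 - d.  Such a quadratic is separable
      iff d <> 0, and two of them are coprime iff their d differ.  So the
      vertical triples correspond to x together with three distinct nonzero
      values of d, and there are q (q-1)(q-2)(q-3) of them.
    - On a line of slope m they are (X + m)^2 + 2y (X + m) + e, with e the
      common value of the pencil at -m.  The discriminant is 4 (y^2 - e), and
      two members have resultant e (2 (y - y'))^2.  So the triples are given by
      m, a nonzero e, and three distinct y that are not square roots of e.

    The number k_e of square roots of a nonzero e is 0 or 2, and for both values
    (q-k)(q-k-1)(q-k-2) agrees with q(q-1)(q-2) - 3 k (q-2)^2, which is affine
    in k.  Hence the sum over e needs only the total of the k_e over
    e <> 0, which is q - 1 ([sum_ffact_nonsqrts]).  This gives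
    q (q-1)(q-2)(q^2-4q+6) oblique triples, and adding the vertical ones gives
    the cardinality of D. *)

Set Implicit Arguments.
Unset Strict Implicit.
Unset Printing Implicit Defensive.

Import GRing.Theory.
Import Order.TTheory Num.Theory.
Local Open Scope ring_scope.

(** * Monic quadratics through their coefficients *)

Section Coefficients.
Variable F : finFieldType.
Implicit Types (u v w : mquad F) (g : aff F).

Lemma mquadE u : u = 'X^2 + u`_1 *: 'X + (u`_0)%:P :> {poly F}.
Proof. by rewrite -[in LHS](mquad_coefsK u). Qed.

Lemma mquad_of_coef1 (c : F * F) : (mquad_of c)`_1 = c.1.
Proof. by rewrite /= !coefE /= mulr1 addr0 add0r. Qed.

Lemma mquad_of_coef0 (c : F * F) : (mquad_of c)`_0 = c.2.
Proof. by rewrite /= !coefE /= mulr0 !add0r. Qed.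

Lemma mquad_ext u v : u`_1 = v`_1 -> u`_0 = v`_0 -> u = v.
Proof.
by move=> e1 e0; apply: (can_inj (@mquad_coefsK F)); rewrite /mquad_coefs e1 e0.
Qed.

Definition disc u : F := u`_1 ^+ 2 - 4 * u`_0.

(** The resultant of [u] and [v], written as that of [u] and the linear
    polynomial [u - v]. *)
Definition res u v : F :=
  (u`_0 - v`_0) ^+ 2 - (u`_1 - v`_1) * (u`_0 - v`_0) * u`_1
    + (u`_1 - v`_1) ^+ 2 * u`_0.

(** For nonzero [c] the right-hand side is [c ^+ 2] times the value of [u] at
    the root [- d / c]; this homogeneous form remains right at [c = 0]. *)
Lemma coprimep_linear u (c d : F) :
  coprimep u (c *: 'X + d%:P) = (d ^+ 2 - c * d * u`_1 + c ^+ 2 * u`_0 != 0).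
Proof.
have [->|c0] := eqVneq c 0.
  rewrite scale0r add0r !mul0r subr0 expr0n mul0r addr0 expf_eq0 /=.
  have [->|d0] := eqVneq d 0.
    rewrite coprimep0 -size_poly_eq1; have /andP[_ /eqP->] := mquadP u.
    by [].
  by rewrite /= -alg_polyC coprimepZr // coprimep1.
have -> : c *: 'X + d%:P = c *: ('X - (- (d / c))%:P).
  by rewrite polyCN opprK scalerDr scale_polyC mulrC divfK.
rewrite coprimepZr // coprimep_XsubC rootE {1}mquadE !hornerE; congr (~~ _).
rewrite -(inj_eq (mulfI (expf_neq0 2 c0))) mulr0; congr (_ == 0).
by field.
Qed.

Lemma separableE u : separable_poly u = (disc u != 0).
Proof.
rewrite unlock.
have -> : u^`() = 2 *: 'X + (u`_1)%:P.
  rewrite {1}mquadE !derivD derivZ derivXn derivX derivC.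
  by rewrite alg_polyC addr0 scaler_nat.
rewrite coprimep_linear -oppr_eq0; congr (_ != 0); rewrite /disc; ring.
Qed.

(** The difference [u - v] is linear because both quadratics are monic. *)
Lemma coprimepE u v : coprimep u v = (res u v != 0).
Proof.
have E : v = 1 * (u : {poly F}) +
    (-1) *: ((u`_1 - v`_1) *: 'X + (u`_0 - v`_0)%:P) :> {poly F}.
  have := mquadE u; have := mquadE v.
  move: (u`_1) (u`_0) (v`_1) (v`_0) => u1 u0 v1 v0 -> ->.
  rewrite scaleN1r -!mul_polyC !polyCB; ring.
rewrite {1}E coprimep_addl_mul coprimepZr ?oppr_eq0 ?oner_neq0 //.
exact: coprimep_linear.
Qed.

Definition collinear u v w : F :=
  (u`_0 - v`_0) * (v`_1 - w`_1) - (v`_0 - w`_0) * (u`_1 - v`_1).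

Lemma det_dmx u v w : \det (dmx u v w) = collinear u v w.
Proof.
rewrite (expand_det_row _ ord0) !big_ord_recr big_ord0 /= /cofactor.
rewrite !(expand_det_row _ ord0) !big_ord_recr !big_ord0 /= /cofactor.
rewrite !det_mx11 !mxE /= /collinear; ring.
Qed.

Lemma in_calA u v w : ((u, v, w) \in calA F) =
  [&& disc u != 0, disc v != 0, disc w != 0,
      res u v != 0, res u w != 0 & res v w != 0].
Proof. by rewrite inE !separableE !coprimepE. Qed.

Lemma in_calD u v w : ((u, v, w) \in calD F) =
  ((u, v, w) \in calA F) && (collinear u v w == 0).
Proof. by rewrite inE det_dmx. Qed.

Lemma mquad_comp_aff u g :
  u \Po aff_poly g = (aff_a g ^+ 2) *: 'X^2
    + (aff_a g * (2 * aff_b g + u`_1)) *: 'X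
    + (aff_b g ^+ 2 + aff_b g * u`_1 + u`_0)%:P.
Proof.
rewrite {1}mquadE !comp_polyD comp_polyZ comp_polyX comp_polyC comp_Xn_poly.
rewrite /aff_poly -!mul_polyC !(polyCD, polyCM, polyC_exp, polyC_natr); ring.
Qed.

Lemma mquad_act_coef1 u g :
  (mquad_act u g)`_1 = (2 * aff_b g + u`_1) / aff_a g.
Proof.
have a0 := aff_a_neq0 g.
rewrite /= mquad_comp_aff !coefE /= mulr0 add0r addr0 mulr1; by field.
Qed.

Lemma mquad_act_coef0 u g :
  (mquad_act u g)`_0 = (aff_b g ^+ 2 + aff_b g * u`_1 + u`_0) / aff_a g ^+ 2.
Proof.
by rewrite /= mquad_comp_aff !coefE /= !mulr0 !add0r mulrC.
Qed.

End Coefficients.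

(** * Stabilisers in the affine group *)

Section Stabilisers.
Variable F : finFieldType.
Hypothesis F_odd : odd #|F|.
Implicit Types (u v w : mquad F) (g : aff F) (t : triple F) (b : F).

(** Otherwise 1 would have order two in the additive group, whose order is
    odd. *)
Lemma two_neq0 : 2 != 0 :> F.
Proof.
apply/eqP => F2.
have o2 : #[1%R : F]%g = 2%N.
  by apply: nt_prime_order; rewrite ?FinRing.zmodXgE ?oner_neq0.
have := order_dvdG (in_setT (1%R : F)); rewrite o2 cardsT.
by move=> /dvdn_odd/(_ F_odd).
Qed.

Lemma in_Stab u v w g :
  (g \in Stab (u, v, w)) =
  [&& mquad_act u g == u, mquad_act v g == v & mquad_act w g == w].
Proof.
apply/astab1P/and3P => [[->->->]//|[/eqP eu /eqP ev /eqP ew]].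
by rewrite /= /triple_act /= eu ev ew.
Qed.

Lemma mquad_act_iota u b : (mquad_act u (aff_iota b) == u) = (u`_1 == - b).
Proof.
apply/eqP/eqP => [/(congr1 (fun s : mquad F => s`_1))|u1].
  rewrite mquad_act_coef1 /aff_a /aff_b /= invrN1 mulrN1 => /eqP.
  rewrite -subr_eq0 (_ : _ - _ = - (2 * (u`_1 + b))); last by ring.
  by rewrite oppr_eq0 mulf_eq0 (negPf two_neq0) addr_eq0 => /eqP.
apply: mquad_ext.
  by rewrite mquad_act_coef1 /aff_a /aff_b /= u1 invrN1; ring.
by rewrite mquad_act_coef0 /aff_a /aff_b /= u1 sqrrN expr1n invr1; ring.
Qed.

Lemma disc_act u g : disc (mquad_act u g) = disc u / aff_a g ^+ 2.
Proof.
have a0 := aff_a_neq0 g.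
by rewrite /disc mquad_act_coef1 mquad_act_coef0; field.
Qed.

(** The discriminant forces [aff_a g] to be a square root of 1, and the linear
    coefficient then determines [aff_b g]. *)
Lemma mquad_fix u g : disc u != 0 -> mquad_act u g = u ->
  g = 1%g \/ g = aff_iota (- u`_1).
Proof.
move=> du fix_u; have a0 := aff_a_neq0 g.
have := disc_act u g; rewrite fix_u -[LHS]mulr1 => /(mulfI du) a2.
have {a2}/eqP : aff_a g ^+ 2 = 1 by rewrite -[LHS]invrK -a2 invr1.
have := mquad_act_coef1 u g.
rewrite fix_u => /(congr1 ( *%R^~ (aff_a g))); rewrite divfK // => u1.
have b_eq : aff_b g = (u`_1 * aff_a g - u`_1) / 2.
  by rewrite u1; field; exact: two_neq0.
rewrite sqrf_eq1 => /orP[]/eqP a1; [left|right]; apply: aff_ext => //;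
  rewrite b_eq a1 /aff_b /=.
  by rewrite mulr1 subrr mul0r.
by field; exact: two_neq0.
Qed.

Lemma aff_iota_inj : injective (@aff_iota F).
Proof. by move=> b c /(congr1 (@aff_b F)). Qed.

Lemma order_iota b : #[aff_iota b]%g = 2%N.
Proof.
apply: nt_prime_order => //.
  apply: aff_ext; rewrite /aff_a /aff_b /= ?mulrNN ?mulr1 // mulN1r addNr //.
apply/eqP => /(congr1 (@aff_a F)); rewrite /aff_a /= => /eqP.
by rewrite eq_sym -addr_eq0 (negPf two_neq0).
Qed.

Lemma iota_in_Stab u v w b : (aff_iota b \in Stab (u, v, w)) =
  [&& u`_1 == - b, v`_1 == - b & w`_1 == - b].
Proof. by rewrite in_Stab !mquad_act_iota. Qed.

Lemma Stab_subset u v w g : (u, v, w) \in calA F -> g \in Stab (u, v, w) ->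
  g = 1%g \/ g = aff_iota (- u`_1).
Proof.
rewrite in_calA in_Stab => /and3P[du _ _] /and3P[/eqP fix_u _ _].
exact: mquad_fix.
Qed.

Lemma cycle_iota b : <[aff_iota b]>%g = [set 1%g; aff_iota b].
Proof. exact: cycle2g (order_iota b). Qed.

Lemma cycle_iota_inj b c : <[aff_iota b]>%g = <[aff_iota c]>%g -> b = c.
Proof.
move=> bc; have := cycle_id (aff_iota b); rewrite bc cycle_iota !inE.
case/orP=> /eqP; last exact: aff_iota_inj.
by move=> /(congr1 (fun g => #[g]%g)); rewrite order_iota order1.
Qed.

Lemma Stab_eq_iota u v w b : (u, v, w) \in calA F ->
  Stab (u, v, w) = <[aff_iota b]>%g <-> [/\ u`_1 = - b, v`_1 = - b & w`_1 = - b].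
Proof.
move=> tA; split=> [Sb|[ub vb wb]].
  have := cycle_id (aff_iota b); rewrite -Sb iota_in_Stab.
  by case/and3P=> /eqP-> /eqP-> /eqP->.
have Sb : aff_iota b \in Stab (u, v, w) by rewrite iota_in_Stab ub vb wb eqxx.
apply/eqP; rewrite eqEsubset cycle_subG Sb andbT; apply/subsetP=> g.
by move=> /(Stab_subset tA)[]->; rewrite ?group1 // ub opprK cycle_id.
Qed.

Lemma Stab_eq1 u v w : (u, v, w) \in calA F ->
  (Stab (u, v, w) == 1%g) = ~~ ((u`_1 == v`_1) && (v`_1 == w`_1)).
Proof.
move=> tA; apply/eqP/idP => [S1|].
  apply/negP=> /andP[/eqP uv /eqP vw].
  have : aff_iota (- u`_1) \in Stab (u, v, w).
    by rewrite iota_in_Stab opprK -vw -uv eqxx.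
  rewrite S1 => /set1P/(congr1 (fun g => #[g]%g)).
  by rewrite order_iota order1.
apply: contraNeq => /trivgPn[g gS /negPf g1].
case: (Stab_subset tA gS) => g_eq; first by rewrite g_eq eqxx in g1.
move: gS; rewrite g_eq iota_in_Stab opprK eqxx /= => /andP[/eqP-> /eqP->].
by rewrite eqxx.
Qed.

End Stabilisers.

(** * Counting distinct triples and fibred sets *)

Section Counting.

Definition distinct3 (T : finType) (A : pred T) : {set T * T * T} :=
  [set p : T * T * T | all A [:: p.1.1; p.1.2; p.2] & uniq [:: p.1.1; p.1.2; p.2]].

Lemma card_distinct3 (T : finType) (A : pred T) :
  #|distinct3 A| = (#|A| ^_ 3)%N.
Proof.
rewrite -card_uniq_tuples.
pose f (p : T * T * T) := [tuple p.1.1; p.1.2; p.2].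
have f_inj : injective f.
  by case=> [[a b] c] [[a' b'] c'] /(congr1 val)[] -> -> ->.
rewrite -(card_imset _ f_inj); apply: eq_card => t.
rewrite inE; apply/imsetP/idP => [[p] | tP].
  by rewrite inE => pP ->.
have t_eq : t = f (tnth t 0, tnth t 1, tnth t 2%:R).
  by case/tupleP: t {tP} => a t; case/tupleP: t => b t; case/tupleP: t => c t; 
     rewrite (tuple0 t); apply: val_inj.
exists (tnth t 0, tnth t 1, tnth t 2%:R) => //.
by rewrite inE; move: tP; rewrite {1 2}t_eq.
Qed.

Lemma card_fibred (I T : finType) (A : I -> {set T}) :
  #|[set p : I * T | p.2 \in A p.1]| = (\sum_i #|A i|)%N.
Proof.
rewrite -sum1_card; under [RHS]eq_bigr do rewrite -sum1_card.
by rewrite pair_big_dep; apply: eq_bigl => p; rewrite inE.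
Qed.

(** Over a ring the formula has no truncated subtraction, so it stays valid for
    [n < 3], where both sides vanish. *)
Lemma natr_ffact3 (R : pzRingType) n :
  (n ^_ 3)%:R = n%:R * (n%:R - 1) * (n%:R - 2) :> R.
Proof.
case: n => [|[|[|n]]].
- by rewrite ffact_small // mulr0n !mul0r.
- by rewrite ffact_small // subrr mulr0 mul0r.
- by rewrite ffact_small // subrr mulr0.
rewrite !ffactSS ffactn0 muln1 !natrM.
have subE k : (k <= n.+3)%N -> n.+3%:R - k%:R = (n.+3 - k)%:R :> R.
  by move=> /natrB->.
by rewrite mulrA (subE 1%N) // (subE 2%N).
Qed.
End Counting.

(** * Square roots in a finite field of odd order *)

Section SquareRoots.
Variable F : finFieldType.
Hypothesis F_odd : odd #|F|.

Definition sqrts (e : F) : pred F := [pred y | y ^+ 2 == e].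

Lemma card_sqrts0 : #|sqrts 0| = 1%N.
Proof.
by rewrite -(card1 (0 : F)); apply: eq_card => y; rewrite !inE sqrf_eq0.
Qed.

Lemma card_sqrts_neq0 (e : F) : e != 0 -> #|sqrts e| = 0%N \/ #|sqrts e| = 2%N.
Proof.
move=> e0; case: (pickP (sqrts e)) => [y /eqP y2|none]; last by left; exact: eq_card0.
right; have y0 : y != 0 by apply: contraNneq e0 => y0; rewrite -y2 y0 expr0n.
have yNy : y != - y.
  by rewrite -addr_eq0 -mulr2n -mulr_natl mulf_neq0 // two_neq0.
have <- : #|[set y; - y]| = 2%N by rewrite cards2 yNy.
apply: eq_card => z.
by rewrite !inE -y2 eqf_sqr.
Qed.

(** Every [y] is a square root of exactly one element. *)
Lemma sum_card_sqrts : (\sum_e #|sqrts e| = #|F|)%N.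
Proof.
rewrite -[RHS]sum1_card [RHS](partition_big (fun y : F => y ^+ 2) xpredT) //=.
by apply: eq_bigr => e _; rewrite -sum1_card.
Qed.

Lemma natr_card_neq0 : #|[pred e : F | e != 0]|%:R = #|F|%:R - 1 :> rat.
Proof. by rewrite -(cardC (pred1 (0 : F))) card1 natrD addrAC subrr add0r. Qed.

(** Since the number [k] of square roots of a nonzero [e] is 0 or 2, the cubic
    [(q - k) (q - k - 1) (q - k - 2)] may be replaced by its affine
    interpolation in [k] at these two points; the individual numbers [k] then
    enter only through their sum. *)
Lemma sum_ffact_nonsqrts (q : rat) : q = #|F|%:R ->
  \sum_(e : F | e != 0) (#|predC (sqrts e)| ^_ 3)%:R =
    (q - 1) * (q - 2) * (q ^+ 2 - 4 * q + 6).
Proof.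
move=> qE.
have card_C e : (#|predC (sqrts e)|%:R = q - #|sqrts e|%:R :> rat).
  by rewrite qE -(cardC (sqrts e)) natrD addrC addKr.
have termE (e : F) : e != 0 -> (#|predC (sqrts e)| ^_ 3)%:R =
    q * (q - 1) * (q - 2) - 3 * (q - 2) ^+ 2 * #|sqrts e|%:R :> rat.
  move=> e0; rewrite natr_ffact3 card_C.
  by case: (card_sqrts_neq0 e0) => ->; ring.
rewrite (eq_bigr _ termE) sumrB -[X in _ - X]mulr_sumr.
have -> : \sum_(e : F | e != 0) #|sqrts e|%:R = q - 1 :> rat.
  have /(congr1 (fun n => n%:R : rat)) := sum_card_sqrts.
  rewrite (bigD1 (0 : F)) //= card_sqrts0 natrD natr_sum -qE => <-.
  by rewrite addrAC subrr add0r.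
have -> : \sum_(e : F | e != 0) (q * (q - 1) * (q - 2)) =
    (q - 1) * (q * (q - 1) * (q - 2)).
  rewrite sumr_const -[LHS]mulr_natl; congr (_ * _).
  by rewrite qE natr_card_neq0.
ring.
Qed.
End SquareRoots.

(** * Pencils: parametrising the collinear triples *)

Section Pencils.
Variable F : finFieldType.
Hypothesis F_odd : odd #|F|.
Implicit Types (u v w : mquad F) (x y d m e : F).

(** The quadratic [(X + x)^2 - d]; for fixed [x] it runs through a vertical line. *)
Definition vquad x d : mquad F := mquad_of (2 * x, x ^+ 2 - d).

Definition vtriple (p : F * (F * F * F)) : triple F :=
  let: (x, (d1, d2, d3)) := p in (vquad x d1, vquad x d2, vquad x d3).

(** The quadratic [(X + m)^2 + 2y (X + m) + e]; for fixed [m] and [e] it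
    runs through a line of slope [m].  It takes the value [e] at [- m], so the
    members of the line have a common root iff [e = 0]. *)
Definition pquad m e y : mquad F :=
  mquad_of (2 * (y + m), m ^+ 2 + 2 * m * y + e).

Definition ptriple (p : F * F * (F * F * F)) : triple F :=
  let: (m, e, (y1, y2, y3)) := p in (pquad m e y1, pquad m e y2, pquad m e y3).

Let two0 := two_neq0 F_odd.
Let four0 : 4 != 0 :> F.
Proof. by rewrite (_ : 4 = 2 * 2); [rewrite mulf_neq0 | ring]. Qed.

Lemma vtriple_inj : injective vtriple.
Proof.
have E x d x' d' : vquad x d = vquad x' d' -> x = x' /\ d = d'.
  move=> E; have := congr1 (fun s : mquad F => s`_1) E.
  rewrite !mquad_of_coef1 => /(mulfI two0) ?; subst x'; split => //.
  have := congr1 (fun s : mquad F => s`_0) E.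
  by rewrite !mquad_of_coef0 => /addrI/oppr_inj.
case=> [x [[d1 d2] d3]] [x' [[d1' d2'] d3']] /= /eqP.
rewrite !xpair_eqE -andbA => /and3P[].
by move=> /eqP/E[<- <-] /eqP/E[_ <-] /eqP/E[_ <-].
Qed.

(** Two distinct points of the line recover the slope [m], and then everything
    else; with equal points a line through them would not be determined. *)
Lemma ptriple_inj : {in [pred p | p.2.1.1 != p.2.1.2] &, injective ptriple}.
Proof.
have E m e y m' e' y' : pquad m e y = pquad m' e' y' ->
    y + m = y' + m' /\ m ^+ 2 + 2 * m * y + e = m' ^+ 2 + 2 * m' * y' + e'.
  move=> E; have := congr1 (fun s : mquad F => s`_1) E.
  rewrite !mquad_of_coef1 => /(mulfI two0) ?; split => //.
  by have := congr1 (fun s : mquad F => s`_0) E; rewrite !mquad_of_coef0.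
case=> [[m e] [[y1 y2] y3]] [[m' e'] [[y1' y2'] y3']].
rewrite !inE /= => y12 _ /eqP; rewrite !xpair_eqE -andbA => /and3P[].
move=> /eqP/E[a1 b1] /eqP/E[a2 b2] /eqP/E[a3 b3].
have mm : m = m'.
  have dy : y1' - y2' = y1 - y2 by rewrite -[y1](addrK m) -[y2](addrK m) a1 a2; ring.
  have : 2 * (y1 - y2) != 0 by rewrite mulf_neq0 // subr_eq0.
  move=> /mulfI; apply.
  transitivity ((m ^+ 2 + 2 * m * y1 + e) - (m ^+ 2 + 2 * m * y2 + e)); first by ring.
  by rewrite b1 b2 -dy; ring.
subst m'; move: a1 a2 a3 => /addIr ? /addIr ? /addIr ?; subst.
by move: b1 => /addrI ->.
Qed.

Lemma vtriple_in_calD x d1 d2 d3 : (vtriple (x, (d1, d2, d3)) \in calD F) =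
  ((d1, d2, d3) \in distinct3 [pred d | d != 0]).
Proof.
have discE d : (disc (vquad x d) == 0) = (d == 0).
  have -> : disc (vquad x d) = 4 * d.
    by rewrite /disc mquad_of_coef1 mquad_of_coef0 /=; ring.
  by rewrite mulf_eq0 (negPf four0).
have resE d d' : (res (vquad x d) (vquad x d') == 0) = (d == d').
  have -> : res (vquad x d) (vquad x d') = (d - d') ^+ 2.
    by rewrite /res !mquad_of_coef1 !mquad_of_coef0 /=; ring.
  by rewrite sqrf_eq0 subr_eq0.
rewrite in_calD in_calA !discE !resE (_ : collinear _ _ _ = 0).
  by rewrite eqxx andbT inE /= !inE !andbT negb_or -!andbA.
rewrite /collinear !mquad_of_coef1 !mquad_of_coef0 /=; ring.
Qed.

Lemma ptriple_in_calD m e y1 y2 y3 : (ptriple (m, e, (y1, y2, y3)) \in calD F) =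
  (e != 0) && ((y1, y2, y3) \in distinct3 (predC (sqrts e))).
Proof.
have discE y : (disc (pquad m e y) == 0) = (y ^+ 2 == e).
  have -> : disc (pquad m e y) = 4 * (y ^+ 2 - e).
    by rewrite /disc mquad_of_coef1 mquad_of_coef0 /=; ring.
  by rewrite mulf_eq0 (negPf four0) subr_eq0.
have resE y y' : (res (pquad m e y) (pquad m e y') == 0) = (y == y') || (e == 0).
  have -> : res (pquad m e y) (pquad m e y') = (2 * (y - y')) ^+ 2 * e.
    by rewrite /res !mquad_of_coef1 !mquad_of_coef0 /=; ring.
  by rewrite mulf_eq0 sqrf_eq0 mulf_eq0 (negPf two0) subr_eq0.
rewrite in_calD in_calA !discE !resE (_ : collinear _ _ _ = 0).
  rewrite eqxx andbT inE /= !inE !andbT !negb_or.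
  by case: (e == 0); rewrite /= ?andbF ?andbT -?andbA.
rewrite /collinear !mquad_of_coef1 !mquad_of_coef0 /=; ring.
Qed.

Definition vertical (t : triple F) : bool :=
  let: (u, v, w) := t in (u`_1 == v`_1) && (v`_1 == w`_1).

Lemma vtriple_vertical p : vertical (vtriple p).
Proof.
by case: p => x [[d1 d2] d3]; rewrite /vertical /vtriple !mquad_of_coef1 !eqxx.
Qed.

Lemma vertical_vtriple t : vertical t -> exists p, t = vtriple p.
Proof.
case: t => [[u v] w] /andP[/eqP uv /eqP vw].
pose x := u`_1 / 2; pose d (s : mquad F) := x ^+ 2 - s`_0.
exists (x, (d u, d v, d w)).
have E (s : mquad F) : s`_1 = u`_1 -> s = vquad x (d s).
  move=> su; apply: mquad_ext; rewrite ?mquad_of_coef1 ?mquad_of_coef0 /d /x /=.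
    by rewrite su; field.
  ring.
by rewrite /= -!E -?vw -?uv.
Qed.

(** Completing the square at [- m], where [m] is the slope of the line through
    [u] and [v]: the expression [s`_0 - m * s`_1] is constant along that line. *)
Lemma oblique_ptriple u v w : u`_1 != v`_1 -> collinear u v w = 0 ->
  exists p, (u, v, w) = ptriple p.
Proof.
rewrite -subr_eq0 => uv; rewrite /collinear => uvw.
pose m := (u`_0 - v`_0) / (u`_1 - v`_1).
pose y (s : mquad F) := s`_1 / 2 - m.
pose e := u`_0 - m * u`_1 + m ^+ 2.
exists (m, e, (y u, y v, y w)).
have E (s : mquad F) : s`_0 - m * s`_1 = u`_0 - m * u`_1 -> s = pquad m e (y s).
  move=> su; apply: mquad_ext; rewrite ?mquad_of_coef1 ?mquad_of_coef0 /y /=.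
    by field.
  rewrite /e -su; by field.
have Ev : v`_0 - m * v`_1 = u`_0 - m * u`_1 by rewrite /m; field.
have Ew : w`_0 - m * w`_1 = u`_0 - m * u`_1.
  rewrite -Ev; apply/eqP; rewrite -subr_eq0; apply/eqP.
  apply: (mulIf uv); rewrite mul0r -[RHS]uvw /m; by field.
by rewrite /= -!E.
Qed.

(** If [u] and [v] had the same linear coefficient, coprimality would separate
    their constant ones, so they would span a vertical line, and collinearity
    would put [w] on it as well. *)
Lemma calD_oblique_coef1_neq u v w : (u, v, w) \in calD F ->
  ~~ vertical (u, v, w) -> u`_1 != v`_1.
Proof.
rewrite in_calD in_calA => /andP[/and5P[_ _ _ ruv _] /eqP uvw].
apply: contraNneq => uv; rewrite /= uv eqxx /=.
move: ruv uvw; rewrite /res /collinear uv subrr.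
rewrite !mul0r expr0n mul0r subr0 addr0 mulr0 subr0.
rewrite sqrf_eq0 => uv0 /eqP; rewrite mulf_eq0 (negPf uv0) subr_eq0; exact.
Qed.

Lemma ptriple_oblique m e y1 y2 y3 :
  y1 != y2 -> ~~ vertical (ptriple (m, e, (y1, y2, y3))).
Proof.
move=> y12; rewrite /vertical /ptriple !mquad_of_coef1.
by rewrite (inj_eq (mulfI two0)) (inj_eq (addIr _)) (negPf y12).
Qed.

Definition calD_vert : {set triple F} := [set t in calD F | vertical t].

Lemma card_calD_vert (q : rat) : q = #|F|%:R ->
  #|calD_vert|%:R = q * (q - 1) * (q - 2) * (q - 3).
Proof.
move=> qE.
pose P := [set p : F * (F * F * F) | p.2 \in distinct3 [pred d : F | d != 0]].
have PE x d1 d2 d3 : ((x, (d1, d2, d3)) \in P) =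
    (vtriple (x, (d1, d2, d3)) \in calD F).
  by rewrite inE vtriple_in_calD.
have -> : calD_vert = vtriple @: P.
  apply/setP=> t; rewrite inE; apply/andP/imsetP=> [[tD tv]|[p pP ->]].
    have [p tp] := vertical_vtriple tv; exists p => //.
    by move: p tp tD => [x [[d1 d2] d3]] ->; rewrite PE.
  rewrite vtriple_vertical; case: p pP => x [[d1 d2] d3].
  by rewrite PE.
rewrite (card_imset _ vtriple_inj) (card_fibred (fun=> distinct3 _)).
rewrite sum_nat_const card_distinct3 natrM natr_ffact3 natr_card_neq0 -qE; ring.
Qed.

Lemma card_calD_oblique (q : rat) : q = #|F|%:R ->
  #|calD F :\: calD_vert|%:R = q * ((q - 1) * (q - 2) * (q ^+ 2 - 4 * q + 6)).
Proof.
move=> qE.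
(* The line of slope [m] and parameter [e] contributes nothing for [e = 0]: all
   its members vanish at [- m]. *)
pose A e := if e != 0 then distinct3 (predC (sqrts e)) else set0.
pose P := [set p : F * F * (F * F * F) | p.2 \in A p.1.2].
have PE m e y1 y2 y3 : ((m, e, (y1, y2, y3)) \in P) =
    (ptriple (m, e, (y1, y2, y3)) \in calD F).
  by rewrite inE /= ptriple_in_calD /A; case: ifP => // _; rewrite in_set0.
have P_neq p : p \in P -> p.2.1.1 != p.2.1.2.
  case: p => [[m e] [[y1 y2] y3]]; rewrite inE /= /A.
  case: ifP => _; last by rewrite inE.
  by rewrite !inE /= inE negb_or => /andP[_ /andP[/andP[]]].
have -> : calD F :\: calD_vert = ptriple @: P.
  apply/setP=> t; rewrite in_setD inE; apply/andP/imsetP=> [[]|[p pP ->]].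
    case: t => [[u v] w]; move=> + tD; rewrite tD /= => tv.
    have uv := calD_oblique_coef1_neq tD tv.
    have uvw : collinear u v w = 0 by move: tD; rewrite in_calD => /andP[_ /eqP].
    have [p tp] := oblique_ptriple uv uvw; exists p => //.
    by move: p tp tD => [[m e] [[y1 y2] y3]] ->; rewrite PE.
  have := P_neq p pP; case: p pP => [[m e] [[y1 y2] y3]]; rewrite PE => pD /= y12.
  by split=> //; rewrite negb_and (ptriple_oblique _ _ _ y12) orbT.
rewrite card_in_imset; last first.
  by move=> p p' /P_neq pP /P_neq p'P; apply: ptriple_inj; rewrite inE.
rewrite (card_fibred (fun me : F * F => A me.2)) natr_sum.
rewrite -(pair_big xpredT xpredT (fun m e => #|A e|%:R : rat)) /=.
rewrite sumr_const -[LHS]mulr_natl -qE; congr (_ * _).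
rewrite -(sum_ffact_nonsqrts F_odd qE) [RHS]big_mkcond /=.
by apply: eq_bigr => e _; rewrite /A; case: ifP; rewrite ?cards0 ?card_distinct3.
Qed.
End Pencils.

(** * The stabilised locus and the theorem *)

Lemma stab_locusE (F : finFieldType) (F_odd : odd #|F|) :
  stab_locus F = calD_vert F.
Proof.
apply/setP=> [[[u v] w]]; rewrite [LHS]inE [RHS]inE in_calD -andbA.
apply: andb_id2l => tA; rewrite (Stab_eq1 F_odd tA) negbK /vertical.
have [/andP[/eqP uv /eqP vw]|//] := boolP (_ && _); last by rewrite andbF.
by rewrite /collinear uv vw !subrr !mulr0 subrr eqxx.
Qed.

Theorem proposition7p3 (F : finFieldType) (F_odd : odd #|F|) :
  let q : rat := #|F|%:R in
  [/\ (forall u v w : mquad F, (u, v, w) \in calA F ->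
         (Stab (u, v, w) = 1%g
          \/ (exists! b : F, Stab (u, v, w) = <[aff_iota b]>%g)
             /\ Stab (u, v, w) \isog [set: 'Z_2])
         /\ (forall b : F, Stab (u, v, w) = <[aff_iota b]>%g
               <-> [/\ u`_1 = - b, v`_1 = - b & w`_1 = - b])),
      (forall t : triple F, t \in calA F -> Stab t <> 1%g -> t \in calD F)
    & [/\ stab_locus F =
            [set t : triple F in calD F |
               let: (u, v, w) := t in (u`_1 == v`_1) && (v`_1 == w`_1)],
          #|stab_locus F|%:R = q * (q - 1) * (q - 2) * (q - 3),
          #|calD F|%:R = q * (q - 1) * (q - 2) * (q ^+ 2 - 3 * q + 3),
          stab_locus F \proper calD F
        & #|stab_locus F|%:R / #|calD F|%:R = (q - 3) / (q ^+ 2 - 3 * q + 3)]].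
Proof.
move=> q; have qE : q = #|F|%:R by [].
have q_ge3 : (3 <= q)%R.
  have := finRing_gt1 F; rewrite qE (ler_nat _ 3) leq_eqVlt => /predU1P[F2|//].
  by move: F_odd; rewrite -F2.
have card_vert := card_calD_vert F_odd qE.
have card_D : #|calD F|%:R = q * (q - 1) * (q - 2) * (q ^+ 2 - 3 * q + 3).
  have sub : calD_vert F \subset calD F.
    by apply/subsetP=> t; rewrite inE => /andP[].
  rewrite -(cardsID (calD_vert F) (calD F)) (setIidPr sub) natrD card_vert.
  rewrite (card_calD_oblique F_odd qE); ring.
(* The common factor cancels in the density and in the comparison of sizes. *)
have prefix_gt0 : 0 < q * (q - 1) * (q - 2) by nra.
have quad_gt : q - 3 < q ^+ 2 - 3 * q + 3 by nra.
have quad_gt0 : 0 < q ^+ 2 - 3 * q + 3 by nra.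
split.
- move=> u v w tA; split=> [|b]; last exact: Stab_eq_iota.
  have [/eqP ->|] := boolP (Stab (u, v, w) == 1%g); first by left.
  rewrite (Stab_eq1 F_odd tA) negbK => /andP[/eqP uv /eqP vw]; right.
  have Sb : Stab (u, v, w) = <[aff_iota (- u`_1)]>%g.
    by apply/(Stab_eq_iota F_odd _ tA); rewrite opprK -vw -uv.
  split; first by exists (- u`_1); split=> // c; rewrite Sb; exact: cycle_iota_inj.
  have card_Z2 : #|[set: 'Z_2]| = 2%N by rewrite cardsT card_ord.
  rewrite Sb isog_cyclic_card ?cycle_cyclic // prime_cyclic card_Z2 //=.
  by rewrite -orderE order_iota.
- move=> t tA /eqP St; have : t \in stab_locus F by rewrite inE tA.
  by rewrite stab_locusE // inE => /andP[].
rewrite (stab_locusE F_odd); split=> //.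
- rewrite properEcard; apply/andP; split.
    by apply/subsetP=> t; rewrite inE => /andP[].
  by rewrite -(ltr_nat rat) card_vert card_D ltr_pM2l.
rewrite card_vert card_D -mulf_div divff ?mul1r // gt_eqF //.
Qed.
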